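(* Fix $p\in[1,\infty]$. Let $(X,x_0)$ be a pointed set and let $\rho$ be a $p$-subadditive metric on $D(X,x_0)$. Then $\rho\le W_p[i^*\rho,x_0]$.
   Context: A metric on a set $X$ is a function $d:X\times X\to[0,\infty]$ satisfying $d(x,x)=0$, $d(x,y)=d(y,x)$ and $d(x,y)\le d(x,z)+d(z,y)$ (an extended pseudometric). The $p$-norms $\|\cdot\|_p$ are the usual ones on finite tuples ($\max$ of absolute values for $p=\infty$), extended to entries in $[0,\infty]$. A pointed set is a set with a chosen element. $D(X)$ is the free commutative monoid on $X$ (finite formal sums of elements of $X$). $D(X,x_0):=D(X)/D(\{x_0\})$ is the quotient monoid, where $\alpha\sim\beta$ iff $\alpha+\xi=\beta+\eta$ for some $\xi,\eta\in D(\{x_0\})$; thus $D(X,x_0)\cong D(X\setminus\{x_0\})$. The canonical inclusion $i:X\to D(X,x_0)$ sends $x$ to the class of the formal sum $x$ (so $i(x_0)=0$). For a metric $\rho$ on $D(X,x_0)$, the pullback $i^*\rho$ is the metric on $X$ given by $i^*\rho(x,y):=\rho(i(x),i(y))$. A metric $\rho$ on a commutative monoid $M$ is $p$-subadditive if $\rho(a+b,a'+b')\le\|(\rho(a,a'),\rho(b,b'))\|_p$ for all $a,b,a',b'\in M$. For a metric $d$ on $X$, the $p$-Wasserstein distance on $D(X,x_0)$ is $$W_p[d,x_0](x_1+\cdots+x_m,\,x_1'+\cdots+x_n')=\min_{\sigma\in\Sigma_{m+n}}\big\|(d(x_k,x'_{\sigma(k)}))_{k=1}^{m+n}\big\|_p,$$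 where $x_{m+1}=\cdots=x_{m+n}=x'_{n+1}=\cdots=x'_{n+m}=x_0$ and $\Sigma_{m+n}$ is the symmetric group. The inequality between metrics is pointwise. *)

(* Defs.v *)
From HB Require Import structures.
From mathcomp Require Import all_boot all_order all_algebra all_fingroup.
From mathcomp Require Import finmap multiset generic_quotient.
From mathcomp Require Import zify.
From mathcomp Require Import boolp reals constructive_ereal ereal exp.

Set Implicit Arguments.
Unset Strict Implicit.
Unset Printing Implicit Defensive.

Import Order.TTheory GRing.Theory Num.Theory.

Local Open Scope ring_scope.
Local Open Scope quotient_scope.
Local Open Scope ereal_scope.

Section FreeCommutativeMonoid.
Local Open Scope ring_scope.
Variable X : choiceType.

Definition freeCMonoid : Type := {mset X}%mset.
HB.instance Definition _ := Choice.copy freeCMonoid {mset X}%mset.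

Fact freeCMonoid_addA : associative (@msetD X : freeCMonoid -> _ -> freeCMonoid).
Proof. by move=> a b c; apply/msetP => x; rewrite !msetE2 addnA. Qed.

Fact freeCMonoid_addC : commutative (@msetD X : freeCMonoid -> _ -> freeCMonoid).
Proof. by move=> a b; apply: msetDC. Qed.

Fact freeCMonoid_add0 :
  left_id (mset0 : freeCMonoid) (@msetD X : freeCMonoid -> _ -> freeCMonoid).
Proof. by move=> a; apply/msetP => x; rewrite msetE2 mset0E. Qed.

HB.instance Definition _ := GRing.isNmodule.Build freeCMonoid
  freeCMonoid_addA freeCMonoid_addC freeCMonoid_add0.

Definition freeGen (x : X) : freeCMonoid := [mset x]%mset.

Lemma freeCMonoid_addE (a b : freeCMonoid) (x : X) :
  ((a + b)%R : {mset X}%mset) x = ((a : {mset X}%mset) x + (b : {mset X}%mset) x)%N.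
Proof. exact: (@msetE2 X a b x).1.1.1. Qed.

Lemma sum_freeGen (s : seq X) :
  \sum_(x <- s) freeGen x = (seq_mset s : freeCMonoid).
Proof.
elim: s => [|x s IHs].
  by rewrite big_nil; apply/msetP => y; rewrite mset_seqE [LHS]mset0E.
rewrite big_cons IHs; apply/msetP => y.
by rewrite freeCMonoid_addE !mset_seqE msetnE /= eq_sym; case: eqP.
Qed.

End FreeCommutativeMonoid.

Section QuotientByBasepoint.
Local Open Scope ring_scope.
Variables (X : choiceType) (x0 : X).

(* The formal sum [xi] lies in the submonoid D({x0}) of D(X). *)
Definition supported_at (xi : freeCMonoid X) : Prop :=
  forall x : X, (x \in (xi : {mset X}%mset)) -> x = x0.

Lemma supported_at0 : supported_at 0.
Proof. by move=> x; rewrite [_ \in _]in_mset0. Qed.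

Lemma supported_atD xi eta :
  supported_at xi -> supported_at eta -> supported_at (xi + eta).
Proof. by move=> hx he x; rewrite [_ \in _]in_msetD => /orP[/hx|/he]. Qed.

Definition base_rel (a b : freeCMonoid X) : bool :=
  `[< exists xi eta, [/\ supported_at xi, supported_at eta & a + xi = b + eta] >].

Lemma base_rel_refl : reflexive base_rel.
Proof.
by move=> a; apply/asboolP; exists 0, 0; split=> //; apply: supported_at0.
Qed.

Lemma base_rel_sym : symmetric base_rel.
Proof.
by move=> a b; apply/asboolP/asboolP => -[xi [eta [h1 h2 h3]]]; exists eta, xi.
Qed.

Lemma base_rel_trans : transitive base_rel.
Proof.
move=> b a c /asboolP[xi [eta [h1 h2 h3]]] /asboolP[xi' [eta' [h1' h2' h3']]].
apply/asboolP; exists (xi + xi'), (eta' + eta); split;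
  [exact: supported_atD | exact: supported_atD |].
by rewrite addrA h3 addrAC h3' addrA.
Qed.

Canonical base_rel_equiv := EquivRel base_rel
  base_rel_refl base_rel_sym base_rel_trans.

(* D(X, x0), the quotient of D(X) by D({x0}). *)
Definition relCMonoid : Type := {eq_quot base_rel}.
HB.instance Definition _ : EqQuotient _ base_rel relCMonoid :=
  EqQuotient.on relCMonoid.
HB.instance Definition _ := Choice.on relCMonoid.

Lemma base_rel_add a a' b b' :
  base_rel a a' -> base_rel b b' -> base_rel (a + b) (a' + b').
Proof.
move=> /asboolP[xi [eta [h1 h2 h3]]] /asboolP[xi' [eta' [h1' h2' h3']]].
apply/asboolP; exists (xi + xi'), (eta + eta'); split;
  [exact: supported_atD | exact: supported_atD |].
by rewrite addrACA h3 h3' addrACA.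
Qed.

Definition relCMonoid_zero : relCMonoid := \pi_relCMonoid (0 : freeCMonoid X).
Definition relCMonoid_add (u v : relCMonoid) : relCMonoid :=
  \pi_relCMonoid (repr u + repr v).

Lemma relCMonoid_pi_add (a b : freeCMonoid X) :
  relCMonoid_add (\pi_relCMonoid a) (\pi_relCMonoid b) = \pi_relCMonoid (a + b).
Proof.
rewrite /relCMonoid_add; apply/eqmodP; apply: base_rel_add;
  by apply/eqmodP; rewrite reprK.
Qed.

Fact relCMonoid_addA : associative relCMonoid_add.
Proof.
move=> u v w; rewrite -[u]reprK -[v]reprK -[w]reprK.
move: (repr u) (repr v) (repr w) => a b c.
rewrite (relCMonoid_pi_add b) (relCMonoid_pi_add a b).
by rewrite (relCMonoid_pi_add a) (relCMonoid_pi_add _ c) addrA.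
Qed.

Fact relCMonoid_addC : commutative relCMonoid_add.
Proof. by move=> u v; rewrite /relCMonoid_add addrC. Qed.

Fact relCMonoid_add0 : left_id relCMonoid_zero relCMonoid_add.
Proof.
move=> u; rewrite -[u]reprK; move: (repr u) => a.
by rewrite relCMonoid_pi_add add0r.
Qed.

HB.instance Definition _ := GRing.isNmodule.Build relCMonoid
  relCMonoid_addA relCMonoid_addC relCMonoid_add0.

Definition relGen (x : X) : relCMonoid := \pi_relCMonoid (freeGen x).

Lemma relGen_base : relGen x0 = 0.
Proof.
apply/eqmodP/asboolP; exists 0, (freeGen x0).
split; [exact: supported_at0 | | by rewrite addr0 add0r].
by move=> x; rewrite [_ \in _]in_mset1 => /eqP.
Qed.

Lemma sum_relGen (s : seq X) :
  \sum_(x <- s) relGen x = \pi_relCMonoid (\sum_(x <- s) freeGen x).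
Proof.
elim: s => [|x s IHs]; first by rewrite !big_nil.
by rewrite !big_cons IHs [LHS]relCMonoid_pi_add.
Qed.

End QuotientByBasepoint.

Section Metrics.
Variable R : realType.

(* An extended pseudometric: +oo is allowed, and so is d x y = 0 with x <> y. *)
Definition is_metric (X : Type) (d : X -> X -> \bar R) : Prop :=
  [/\ forall x y, 0 <= d x y,
      forall x, d x x = 0,
      forall x y, d x y = d y x
    & forall x y z, d x y <= d x z + d z y].

(* Meaningful for [1 <= p] only; the value at [p = -oo] is a dummy. Entries may
   be infinite, since [+oo `^ r = +oo] for [r != 0]. *)
Definition pnorm (p : \bar R) (s : seq (\bar R)) : \bar R :=
  match p with
  | r%:E => (\sum_(x <- s) `|x| `^ r) `^ r^-1
  | +oo => \big[maxe/0]_(x <- s) `|x|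
  | -oo => 0
  end.

Definition p_subadditive (p : \bar R) (M : nmodType) (rho : M -> M -> \bar R) :
    Prop :=
  forall a b a' b' : M,
    rho (a + b)%R (a' + b')%R <= pnorm p [:: rho a a'; rho b b'].

Definition pullback (X Y : Type) (f : X -> Y) (rho : Y -> Y -> \bar R) :
    X -> X -> \bar R :=
  fun x y => rho (f x) (f y).

(* The Wasserstein formula for x_1 + ... + x_m and x'_1 + ... + x'_n, given as
   the sequences [s] and [t]. The minimum ranges over a nonempty finite type, so
   the default value [+oo] plays no role. *)
Definition wasserstein_seq (p : \bar R) (X : Type) (d : X -> X -> \bar R)
    (x0 : X) (s t : seq X) : \bar R :=
  let m := size s in let n := size t in
  let s' := s ++ nseq n x0 in let t' := t ++ nseq m x0 in
  \big[mine/+oo]_(sigma : 'S_(m + n))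
    pnorm p [seq d (nth x0 s' k) (nth x0 t' (sigma k)) | k : 'I_(m + n) <- enum 'I_(m + n)].

(* Stated on the chosen representatives; [wassersteinE] below shows that the
   formula holds for all representatives. *)
Definition wasserstein (p : \bar R) (X : choiceType) (d : X -> X -> \bar R)
    (x0 : X) (u v : relCMonoid x0) : \bar R :=
  wasserstein_seq p d x0 (repr u : {mset X}%mset) (repr v : {mset X}%mset).

End Metrics.

Arguments wasserstein {R} p {X} d x0 u v.

Section WassersteinWellDefined.
Variables (R : realType) (p : \bar R) (X : choiceType).
Variables (d : X -> X -> \bar R) (x0 : X).
Hypothesis p_ge1 : 1 <= p.
Hypothesis d00 : d x0 x0 = 0.

Lemma pnorm_perm (s t : seq (\bar R)) : perm_eq s t -> pnorm p s = pnorm p t.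
Proof.
move=> st; rewrite /pnorm; case: p => [r| |] //; last exact: perm_big.
by congr (_ `^ _); apply: perm_big.
Qed.

Lemma pnorm_cons0 (s : seq (\bar R)) : pnorm p (0 :: s) = pnorm p s.
Proof.
rewrite /pnorm; move: p_ge1; case: p => [r| |] // r1; last first.
  rewrite big_cons abse0 max_r//.
  by elim/big_ind : _ => // a b a0 b0; rewrite le_max a0.
rewrite big_cons abse0 poweR0r ?add0e//.
by rewrite gt_eqF// (lt_le_trans ltr01)// -lee_fin.
Qed.

(* The cost of a best matching of two sequences of the same length, described
   by the list of matched pairs. *)
Let cost (Z : seq (X * X)) := pnorm p [seq d z.1 z.2 | z <- Z].
Let matching (S T : seq X) (Z : seq (X * X)) :=
  perm_eq (unzip1 Z) S && perm_eq (unzip2 Z) T.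
Let M N (S T : seq X) := \big[mine/+oo]_(sigma : 'S_N)
  pnorm p [seq d (nth x0 S k) (nth x0 T (sigma k)) | k : 'I_N <- enum 'I_N].

Let map_nth_ord N (S : seq X) : size S = N ->
  [seq nth x0 S k | k : 'I_N <- enum 'I_N] = S.
Proof.
move=> sS; rewrite -[RHS](mkseq_nth x0) /mkseq sS -val_enum_ord -map_comp.
exact: eq_map.
Qed.

Let MB N S T : size S = N -> size T = N ->
  exists2 Z, matching S T Z & M N S T = cost Z.
Proof.
move=> sS sT; rewrite /M.
have [|sg _ ->] := @eq_bigmin _ _ _ (+oo : \bar R) 1%g xpredT
  (fun sigma : 'S_N => pnorm p
    [seq d (nth x0 S k) (nth x0 T (sigma k)) | k : 'I_N <- enum 'I_N]) isT.
  by move=> *; apply: leey.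
exists [seq (nth x0 S k, nth x0 T (sg k)) | k : 'I_N <- enum 'I_N].
  rewrite /matching; apply/andP; split.
    rewrite /unzip1 -map_comp -[X in perm_eq _ X](map_nth_ord sS).
    by rewrite (eq_map (g := fun k : 'I_N => nth x0 S k)).
  rewrite /unzip2 -map_comp.
  rewrite (eq_map (g := (fun k : 'I_N => nth x0 T k) \o sg))// map_comp.
  rewrite -[X in perm_eq _ X](map_nth_ord sT); apply: perm_map.
  apply: uniq_perm.
  - by rewrite map_inj_uniq ?enum_uniq//; apply: perm_inj.
  - exact: enum_uniq.
  - move=> k; rewrite mem_enum; apply/mapP; exists (sg^-1 k)%g.
      by rewrite mem_enum.
    by rewrite permKV.
by rewrite /cost -map_comp.
Qed.

Let MA N S T Z : size S = N -> size T = N -> matching S T Z ->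
  M N S T <= cost Z.
Proof.
move=> sS sT /andP[ZS ZT].
have [Z' ZZ' Z'S] : exists2 Z', perm_eq Z' Z & unzip1 Z' = S.
  have /(perm_iotaP x0) [I pI ->] : perm_eq S (unzip1 Z) by rewrite perm_sym.
  exists (map (nth (x0, x0) Z) I).
    apply/(perm_iotaP (x0, x0)); exists I => //.
    by move: pI; rewrite size_map.
  rewrite /unzip1 -map_comp; apply/eq_in_map => k.
  rewrite (perm_mem pI) mem_iota size_map/= add0n => kZ.
  by rewrite (nth_map (x0, x0)).
have Z'T : perm_eq (unzip2 Z') T by apply: perm_trans ZT; apply: perm_map.
rewrite /cost (pnorm_perm (t := [seq d z.1 z.2 | z <- Z'])); last first.
  by apply: perm_map; rewrite perm_sym.
have szT : size T == N by apply/eqP.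
have /tuple_permP [sg Esg] : perm_eq (unzip2 Z') (Tuple szT) by [].
rewrite /M; apply: (@bigmin_inf _ _ _ _ sg) => //.
rewrite le_eqVlt; apply/orP; left; apply/eqP; congr pnorm.
have sZ' : size Z' = N by rewrite -sS -Z'S size_map.
have sE : size (enum 'I_N) = N by apply: size_enum_ord.
apply: (@eq_from_nth _ 0); first by rewrite [LHS]size_map [RHS]size_map sE sZ'.
move=> i; rewrite size_map sE => iN.
rewrite (nth_map (Ordinal iN)) ?sE//.
rewrite (nth_map (x0, x0)) ?sZ'//.
have -> : nth (Ordinal iN) (enum 'I_N) i = Ordinal iN.
  by apply: val_inj; rewrite /= nth_enum_ord.
congr (d _ _); first by rewrite -Z'S (nth_map (x0, x0)) ?sZ'.
have -> : (nth (x0, x0) Z' i).2 = nth x0 (unzip2 Z') i.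
  by rewrite (nth_map (x0, x0)) ?sZ'.
rewrite Esg (nth_map (Ordinal iN)) ?size_enum_ord//.
rewrite (tnth_nth x0) /=; congr (nth _ _ (sg _)).
by apply: val_inj; rewrite /= nth_enum_ord.
Qed.

Let M_perm N S T S' T' : size S = N -> size T = N ->
  perm_eq S S' -> perm_eq T T' -> M N S T = M N S' T'.
Proof.
move=> sS sT SS' TT'.
have sS' : size S' = N by rewrite -(perm_size SS').
have sT' : size T' = N by rewrite -(perm_size TT').
apply/eqP; rewrite eq_le; apply/andP; split.
  have [Z /andP[h1 h2] ->] := MB sS' sT'; apply: MA => //; apply/andP.
  by split; [apply: perm_trans h1 _|apply: perm_trans h2 _]; rewrite perm_sym.
have [Z /andP[h1 h2] ->] := MB sS sT; apply: MA => //; apply/andP.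
by split; [apply: perm_trans h1 _|apply: perm_trans h2 _].
Qed.

Let M_cons0 N S T : size S = N -> size T = N ->
  (N <= count_mem x0 S + count_mem x0 T)%N ->
  M N.+1 (x0 :: S) (x0 :: T) = M N S T.
Proof.
move=> sS sT cN; apply/eqP; rewrite eq_le; apply/andP; split.
  have [Z /andP[h1 h2] ->] := MB sS sT.
  have -> : cost Z = cost ((x0, x0) :: Z) by rewrite /cost /= d00 pnorm_cons0.
  by apply: MA; rewrite /= ?sS ?sT// /matching /= !perm_cons h1.
have [||Z /andP[h1 h2] ->] := @MB N.+1 (x0 :: S) (x0 :: T);
  rewrite /= ?sS ?sT//.
have Z0 : (x0, x0) \in Z.
  have c1 : count (fun z => z.1 == x0) Z = (count_mem x0 S).+1.
    by rewrite -(count_map fst (pred1 x0)) (seq.permP h1) /= eqxx.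
  have c2 : count (fun z => z.2 == x0) Z = (count_mem x0 T).+1.
    by rewrite -(count_map snd (pred1 x0)) (seq.permP h2) /= eqxx.
  have sZ : size Z = N.+1 by rewrite -(size_map fst) (perm_size h1) /= sS.
  have := count_predUI (fun z : X * X => z.1 == x0) (fun z => z.2 == x0) Z.
  rewrite c1 c2 => E.
  have : (0 < count (predI (fun z : X * X => z.1 == x0) (fun z => z.2 == x0)) Z)%N.
    have := count_size (predU (fun z : X * X => z.1 == x0) (fun z => z.2 == x0)) Z.
    rewrite sZ => U; rewrite -(ltn_add2l N.+1) addn0.
    apply: leq_trans (leq_add U (leqnn _)).
    by rewrite E addSn addnS ltnS ltnS.
  rewrite -has_count => /hasP[[y z] yz /= /andP[/eqP y0 /eqP z0]].
  by rewrite -{1}y0 -z0.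
have pZ := perm_to_rem Z0.
have -> : cost Z = cost (rem (x0, x0) Z).
  rewrite /cost (pnorm_perm (perm_map (fun z => d z.1 z.2) pZ)) /= d00.
  by rewrite pnorm_cons0.
apply: MA => //; apply/andP; split.
  rewrite -(perm_cons x0) -(permPr h1).
  by have := perm_map fst pZ; rewrite perm_sym.
rewrite -(perm_cons x0) -(permPr h2).
by have := perm_map snd pZ; rewrite perm_sym.
Qed.

Let M_nseq0 j N S T : size S = N -> size T = N ->
  (N <= count_mem x0 S + count_mem x0 T)%N ->
  M (j + N) (nseq j x0 ++ S) (nseq j x0 ++ T) = M N S T.
Proof.
move=> sS sT cN; elim: j => // j IHj; rewrite addSn /= M_cons0 ?IHj//.
- by rewrite size_cat size_nseq sS.
- by rewrite size_cat size_nseq sT.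
rewrite !count_cat !count_nseq /= eqxx mul1n addnACA addnn -addnn.
by apply: leq_add => //; apply: leq_addr.
Qed.

Let nz (s : seq X) := [seq x <- s | x != x0].

Let nzP s : perm_eq s (nseq (count_mem x0 s) x0 ++ nz s).
Proof.
have -> : nseq (count_mem x0 s) x0 = seq.filter (pred1 x0) s.
  by elim: s => //= x s <-; case: eqP => [->|].
by rewrite perm_sym; apply/permPl; apply: perm_filterC.
Qed.

Let wasserstein_seq_nz s t :
  wasserstein_seq p d x0 s t = wasserstein_seq p d x0 (nz s) (nz t).
Proof.
set a := count_mem x0 s; set b := count_mem x0 t.
have sa : size s = (a + size (nz s))%N.
  by rewrite (perm_size (nzP s)) size_cat size_nseq.
have sb : size t = (b + size (nz t))%N.
  by rewrite (perm_size (nzP t)) size_cat size_nseq.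
pose N := (size (nz s) + size (nz t))%N.
pose S := nz s ++ nseq (size (nz t)) x0; pose T := nz t ++ nseq (size (nz s)) x0.
have sS : size S = N by rewrite size_cat size_nseq.
have sT : size T = N by rewrite size_cat size_nseq addnC.
rewrite -[RHS]/(M N S T) -(@M_nseq0 (a + b) N S T)//; last first.
  rewrite !count_cat !count_nseq /= eqxx !mul1n /N addnC addnACA addnC; exact: leq_addl.
have NE : (a + b + N = size s + size t)%N by rewrite sa sb /N; lia.
rewrite NE; apply: M_perm.
- by rewrite size_cat size_nseq.
- by rewrite size_cat size_nseq addnC.
- apply/seq.permP => f; rewrite !count_cat (seq.permP (nzP s) f) count_cat.
  by rewrite !count_nseq -/a sb !mulnDr; lia.
- apply/seq.permP => f; rewrite !count_cat (seq.permP (nzP t) f) count_cat.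
  by rewrite !count_nseq -/b sa !mulnDr; lia.
Qed.

Let wasserstein_seq_perm s s' t t' : perm_eq s s' -> perm_eq t t' ->
  wasserstein_seq p d x0 s t = wasserstein_seq p d x0 s' t'.
Proof.
move=> ss' tt'; rewrite /wasserstein_seq -(perm_size ss') -(perm_size tt').
apply: M_perm; rewrite ?perm_cat2r//.
- by rewrite size_cat size_nseq.
- by rewrite size_cat size_nseq addnC.
Qed.

Let nz_repr (s : seq X) :
  perm_eq (nz (repr (\sum_(x <- s) relGen x0 x)%R : {mset X}%mset)) (nz s).
Proof.
rewrite sum_relGen sum_freeGen.
set a := repr _.
have : base_rel x0 a (seq_mset s) by apply/eqmodP; rewrite reprK.
move=> /asboolP[xi [eta [hxi heta E]]].
apply/allP => x _ /=; rewrite !count_filter.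
case: (eqVneq x x0) => [->|xx0].
  rewrite !(@eq_count _ _ pred0) ?count_pred0//;
    by move=> y /=; case: eqP.
have nzE (u : seq X) :
    count [predI pred1 x & (fun y => y != x0)] u = count_mem x u.
  by apply: eq_count => y; rewrite [LHS]andb_idr //= => /eqP ->.
rewrite !nzE count_mem_mset -mset_seqE.
have out (z : freeCMonoid X) : supported_at x0 z -> (z : {mset X}%mset) x = 0%N.
  move=> hz; apply/eqP; rewrite mset_eq0; apply/negP => /hz xE.
  by rewrite xE eqxx in xx0.
have := freeCMonoid_addE a xi x.
by rewrite E freeCMonoid_addE (out xi)// (out eta)// !addn0 => ->.
Qed.

Lemma wassersteinE (s t : seq X) :
  wasserstein p d x0
    (\sum_(x <- s) relGen x0 x)%R (\sum_(y <- t) relGen x0 y)%R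
  = wasserstein_seq p d x0 s t.
Proof.
rewrite /wasserstein wasserstein_seq_nz [RHS]wasserstein_seq_nz.
by apply: wasserstein_seq_perm; apply: nz_repr.
Qed.

End WassersteinWellDefined.

(* Main.v *)
Require Import Defs.
From mathcomp Require Import all_boot all_order all_algebra.
From mathcomp Require Import boolp reals constructive_ereal ereal exp.
From mathcomp Require Import multiset.

(** The distance [W_p] is a minimum over the ways of matching the two formal
    sums, padded with the base point, term by term; so it is enough to bound
    [rho a b] by the cost of each single matching.  A matching presents [a] and
    [b] as sums [\sum_k i (x_k)] and [\sum_k i (x'_(sigma k))] over the same
    index set: padding is harmless because [i x0 = 0], and permuting the terms
    of [b] is harmless because addition commutes.  Subadditivity for two summands
    extends by induction to any number of them ([p_subadditive_sum]), since the
    [p]-norm of a tuple is the [p]-norm of the pair made of its first entry and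
    the norm of the rest ([pnorm_cons]).  The extended inequality, applied to
    these two sums, bounds [rho a b] by the [p]-norm of the distances
    [rho (i (x_k)) (i (x'_(sigma k)))], which is the cost of the matching. *)

Import Order.TTheory GRing.Theory Num.Theory.
Local Open Scope ereal_scope.

Section PNorm.
Context {R : realType} {p : \bar R}.

Lemma pnorm_ge0 (s : seq (\bar R)) : 0 <= pnorm p s.
Proof.
case: p => [r| |] //=; first exact: poweR_ge0.
by elim/big_ind: _ => // x y x0 y0; rewrite le_max x0.
Qed.

Hypothesis p_ge1 : 1 <= p.

Lemma pnorm_nil : pnorm p [::] = 0.
Proof.
move: p_ge1; case: p => [r| |] //=; rewrite ?big_nil // lee_fin => r1.
by rewrite poweR0r// invr_eq0 gt_eqF// (lt_le_trans ltr01).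
Qed.

(** The inner [p]-norm enters the outer one through its [p]-th power (through
    itself if [p = +oo]), so the root and the power cancel; this needs [p != 0]. *)
Lemma pnorm_cons (x : \bar R) (s : seq (\bar R)) :
  pnorm p (x :: s) = pnorm p [:: x; pnorm p s].
Proof.
have := pnorm_ge0 s; move: p_ge1; case: p => [r| |] //=; last first.
  by move=> _ s0; rewrite !big_cons big_nil (gee0_abs s0) (max_l s0).
rewrite lee_fin => r1 s0; congr (_ `^ _).
have r0 : r != 0%R by rewrite gt_eqF// (lt_le_trans ltr01).
rewrite !big_cons big_nil adde0 (gee0_abs s0) -poweRrM mulVf// poweRe1//.
by apply: sume_ge0 => y _; apply: poweR_ge0.
Qed.

Lemma le_pnorm_pair (x y z : \bar R) :
  0 <= y -> y <= z -> pnorm p [:: x; y] <= pnorm p [:: x; z].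
Proof.
move=> y0 yz; have z0 := le_trans y0 yz.
move: p_ge1; case: p => [r| |] //=; rewrite !big_cons !big_nil (gee0_abs y0) (gee0_abs z0).
  rewrite lee_fin => r1; have r0 := le_trans ler01 r1.
  have pow_ge0 := @poweR_ge0 R.
  apply: gt0_ler_poweR; rewrite ?invr_ge0// ?in_itv/= ?leey ?andbT ?adde_ge0//.
  by rewrite leeD2l// leeD2r// gt0_ler_poweR// in_itv/= leey ?y0 ?z0.
by move=> _; apply: le_max2 => //; apply: le_max2.
Qed.

(** Induction on [s]: adding one more summand to both sums costs one use of
    subadditivity, and the outer norm then absorbs the bound for the rest. *)
Lemma p_subadditive_sum {M : nmodType} {rho : M -> M -> \bar R} {I : Type}
    (f g : I -> M) (s : seq I) :
  is_metric rho -> p_subadditive p rho ->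
  rho (\sum_(i <- s) f i)%R (\sum_(i <- s) g i)%R
    <= pnorm p [seq rho (f i) (g i) | i <- s].
Proof.
move=> [rho_ge0 rho0 _ _] rhoD; elim: s => [|i s IHs].
  by rewrite !big_nil rho0 pnorm_ge0.
rewrite !big_cons /= pnorm_cons; apply: (le_trans (rhoD _ _ _ _)).
exact: le_pnorm_pair.
Qed.

End PNorm.

Section Padding.
Context {X : choiceType} {x0 : X}.

Lemma sum_relGen_repr (a : relCMonoid x0) :
  (\sum_(x <- (repr a : {mset X}%mset)) relGen x0 x)%R = a.
Proof. by rewrite sum_relGen sum_freeGen seq_mset_id reprK. Qed.

(** The index type has a free size [N] because the two padded sequences have
    lengths [m + n] and [n + m], while a matching permutes a single index set. *)
Lemma sum_relGen_pad (s : seq X) (n N : nat) : size (s ++ nseq n x0) = N ->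
  (\sum_(k < N) relGen x0 (nth x0 (s ++ nseq n x0) k) =
     \sum_(x <- s) relGen x0 x)%R.
Proof.
move=> <-; rewrite -(big_mkord xpredT (fun k => relGen x0 (nth x0 _ k))).
rewrite -(big_nth x0 xpredT (relGen x0)) big_cat/= [X in (_ + X)%R]big1_seq.
  by rewrite addr0.
by move=> x /= /nseqP[-> _]; apply: relGen_base.
Qed.

End Padding.

Theorem theorem5p4 (R : realType) (p : \bar R) (hp : 1 <= p)
    (X : choiceType) (x0 : X)
    (rho : relCMonoid x0 -> relCMonoid x0 -> \bar R)
    (rho_metric : is_metric rho) (rho_subadd : p_subadditive p rho) :
  forall a b : relCMonoid x0,
    rho a b <= wasserstein p (pullback (relGen x0) rho) x0 a b.
Proof.
move=> a b; rewrite /wasserstein /wasserstein_seq.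
set s : seq X := (repr a : {mset X}%mset).
set t : seq X := (repr b : {mset X}%mset).
apply: le_bigmin => [|sigma _]; first exact: leey.
rewrite -[a in X in X <= _]sum_relGen_repr -[b in X in X <= _]sum_relGen_repr.
rewrite -/s -/t.
rewrite -(sum_relGen_pad s (size t) (size s + size t)) ?size_cat ?size_nseq//.
rewrite -(sum_relGen_pad t (size s) (size s + size t)); last first.
  by rewrite size_cat size_nseq addnC.
rewrite [X in rho _ X <= _](reindex_inj (@perm.perm_inj _ sigma)) /=.
rewrite -[X in rho X _]big_enum -[X in rho _ X]big_enum.
exact: p_subadditive_sum.
Qed.
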